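(* Let $1\le k,k^*<n$. If a left cancellative groupoid $(Q,\cdot)$ of order $n$ is $k$-translatable, then its dual groupoid $(Q,* )$ is $k^*$-translatable if and only if $[kk^*]_n=1$.
   Context: A groupoid is a set with a binary operation $\cdot$. It is left cancellative if $x\cdot y=x\cdot z$ implies $y=z$. The dual groupoid of $(Q,\cdot)$ is $(Q,* )$ with $i*j=j\cdot i$. Here $Q=\{1,\ldots,n\}$, and both $(Q,\cdot)$ and $(Q,* )$ are considered with the natural ordering $1,2,\ldots,n$. For an integer $x$, $[x]_n$ denotes the residue of $x$ modulo $n$, represented in $\{1,\ldots,n\}$, with $0$ identified with $n$. For $1\le k<n$, a groupoid $(Q,\circ)$ on $\{1,\ldots,n\}$ is $k$-translatable if in its multiplication table each row $i$, $2\le i\le n$, is obtained from row $i-1$ by cyclically shifting it $k$ places to the right, i.e. $i\circ j=(i-1)\circ[j-k]_n$ for all $j$ and all $2\le i\le n$. *)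

(* Defs.v *)
From mathcomp Require Import all_boot all_order all_algebra.

Import Order.TTheory GRing.Theory Num.Theory.

Set Implicit Arguments.
Unset Strict Implicit.
Unset Printing Implicit Defensive.

(** The set Q = {1, ..., n}. *)
Definition Q (n : nat) : Type := {i : nat | 1 <= i <= n}.

(** [residue n x] is [x]_n: the representative of x modulo n in {1, ..., n}.
    The remainder (x %% n)%Z is nonnegative for 0 < n, so taking its absolute
    value only converts it to nat. *)
Definition residue (n : nat) (x : int) : nat :=
  let r := `|(x %% n)%Z|%N in if r == 0 then n else r.

Lemma residue_bounds (n : nat) (x : int) : 0 < n -> 1 <= residue n x <= n.
Proof.
move=> n_gt0; rewrite /residue; case: eqP => [_|/eqP r_neq0].
  by rewrite n_gt0 leqnn.
have nZ : (n%:Z != 0)%R by rewrite eqz_nat -lt0n.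
rewrite lt0n r_neq0 /=; apply: ltnW.
by rewrite -ltz_nat gez0_abs ?modz_ge0 // ltz_pmod.
Qed.

Lemma Q_gt0 (n : nat) (i : Q n) : 0 < n.
Proof. by case: i => i /= /andP[]; apply: leq_trans. Qed.

(** [shift_index k j] is [j - k]_n as an element of Q; the existence of j
    guarantees 0 < n. *)
Definition shift_index (n k : nat) (j : Q n) : Q n :=
  exist _ (residue n ((val j)%:Z - k%:Z)%R) (residue_bounds _ (Q_gt0 j)).

(** The index i' is i - 1; as i' is in {1, ..., n}, the rows i concerned
    are exactly those with 2 <= i <= n. *)
Definition translatable (n k : nat) (op : Q n -> Q n -> Q n) : Prop :=
  forall i i' j : Q n, val i = (val i').+1 -> op i j = op i' (shift_index k j).

(** MathComp's [right_injective] says that each map [op x] is injective. *)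
Definition left_cancellative (T : Type) (op : T -> T -> T) : Prop :=
  right_injective op.

Definition dual (T : Type) (op : T -> T -> T) : T -> T -> T :=
  fun i j => op j i.

(* Main.v *)
Require Import Defs.
From mathcomp Require Import all_boot all_order all_algebra.
From mathcomp Require Import ring lra.

Import GRing.Theory.

(** Row [1] of the table determines a [k]-translatable groupoid: undoing the
    [i - 1] shifts that lead to row [i] gives
    [i . j = 1 . [j - k (i - 1)]_n] ([translatable_row1]).

    If moreover [.] is left cancellative, two entries of the table are equal
    exactly when their positions in row [1] are congruent modulo [n]
    ([translatable_entry_eq]).  The dual is [k']-translatable when
    [j . i = [j - k']_n . (i - 1)] for all [j] and all [i >= 2].  The positions
    of these entries in row [1] are [i - k (j - 1)] and
    [i - 1 - k (j - k' - 1)]; they differ by [1 - k k'], whatever [i] and [j]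
    are.  So each of these equations, and there is at least one since [n >= 2],
    amounts to [k k'] being congruent to [1] modulo [n]. *)

Lemma residue_mod {n : nat} (x : int) :
  0 < n -> (Posz (residue n x) = x %[mod n])%Z.
Proof.
move=> n_gt0; have nZ : Posz n != 0 by rewrite eqz_nat -lt0n.
have absE : Posz `|(x %% n)%Z| = (x %% n)%Z by rewrite gez0_abs ?modz_ge0.
rewrite /residue; case: eqP => [r0|_]; last by rewrite absE modz_mod.
by rewrite modzz -absE r0.
Qed.

Lemma residue_eq {n : nat} (x y : int) :
  0 < n -> residue n x = residue n y <-> (x = y %[mod n])%Z.
Proof.
move=> n_gt0; split=> [r_xy|xy]; last by rewrite /residue xy.
by rewrite -(residue_mod x) // r_xy residue_mod.
Qed.

(** A congruence is turned into an equation between integers so that ring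
    arithmetic can combine several of them. *)
Lemma eqz_modP {n : nat} {x y : int} :
  (x = y %[mod n])%Z <-> exists q : int, x = (y + q * Posz n)%R.
Proof.
split=> [/eqP|[q ->]]; last by rewrite addrC modzMDl.
by rewrite eqz_mod_dvd => /dvdzP[q Eq]; exists q; rewrite -Eq addrC subrK.
Qed.

Definition residueQ {n : nat} (n_gt0 : 0 < n) (x : int) : Q n :=
  exist _ (residue n x) (residue_bounds x n_gt0).

Lemma residueQ_eq {n : nat} (n_gt0 : 0 < n) (x y : int) :
  residueQ n_gt0 x = residueQ n_gt0 y <-> (x = y %[mod n])%Z.
Proof.
rewrite -residue_eq //; split=> [/(congr1 val)//|r_xy].
exact: val_inj.
Qed.

Lemma residueQ_val {n : nat} (n_gt0 : 0 < n) (i : Q n) :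
  residueQ n_gt0 (Posz (val i)) = i.
Proof.
apply: val_inj => /=; case: i => i /= /andP[i_gt0 le_in].
rewrite /residue modz_nat absz_nat.
move: le_in; rewrite leq_eqVlt => /predU1P[->|lt_in]; first by rewrite modnn.
by rewrite modn_small // eqn0Ngt i_gt0.
Qed.

Lemma translatable_row1 {n k : nat} (n_gt0 : 0 < n) {op : Q n -> Q n -> Q n} :
  translatable k op -> forall i j : Q n,
  op i j = op (residueQ n_gt0 1)
              (residueQ n_gt0 (Posz (val j) - Posz k * (Posz (val i) - 1))%R).
Proof.
move=> op_trans i; move Em: (val i) => m; elim: m i Em => [|m IHm] i Em j.
  by have := valP i; rewrite Em.
case: m IHm Em => [_|m IHm] Em.
  have -> : residueQ n_gt0 1 = i by rewrite -[RHS](residueQ_val n_gt0) Em.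
  by rewrite subrr mulr0 subr0 residueQ_val.
have m_bounds : 1 <= m.+1 <= n.
  by have /andP[_] := valP i; rewrite Em => /ltnW.
rewrite (op_trans i (exist _ m.+1 m_bounds)) // IHm //; congr (op _).
apply/residueQ_eq/eqz_modP.
have /eqz_modP[q /= ->] := residue_mod (Posz (val j) - Posz k)%R n_gt0.
by exists q; rewrite -!natz; ring.
Qed.

Lemma translatable_entry_eq {n k : nat} {op : Q n -> Q n -> Q n} :
  left_cancellative op -> translatable k op -> forall i j i' j' : Q n,
  op i j = op i' j' <->
  (Posz (val j) - Posz k * (Posz (val i) - 1) =
   Posz (val j') - Posz k * (Posz (val i') - 1) %[mod n])%Z.
Proof.
move=> op_canc op_trans i j i' j'; have n_gt0 := Q_gt0 i.
rewrite (translatable_row1 n_gt0 op_trans i) (translatable_row1 n_gt0 op_trans i').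
rewrite -(residueQ_eq n_gt0).
by split=> [/op_canc|->].
Qed.

(** The instance of [translatable_entry_eq] for the pair of entries compared by
    [k']-translatability of the dual: [i] and [j] cancel out. *)
Lemma dual_shift_eq {n k k' : nat} {op : Q n -> Q n -> Q n} :
  left_cancellative op -> translatable k op -> forall i i' j : Q n,
  val i = (val i').+1 ->
  dual op i j = dual op i' (shift_index k' j) <->
  (Posz (k * k') = 1 %[mod n])%Z.
Proof.
move=> op_canc op_trans i i' j Ei; rewrite /dual.
have /eqz_modP[r Er] : (Posz (val (shift_index k' j)) =
    Posz (val j) - Posz k' %[mod n])%Z by apply: residue_mod; apply: Q_gt0 j.
have succE : Posz (val i) = (Posz (val i') + 1)%R by rewrite Ei -addn1 PoszD.
rewrite (translatable_entry_eq op_canc op_trans) Er succE PoszM.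
rewrite eqz_modP eqz_modP.
move: (Posz (val i')) (Posz (val j)) (Posz k) (Posz k') (Posz n) => x y a b m.
(* The two positions differ by [1 - a b + a r m], where [r m] is the amount by
   which taking the residue changes [y - b]; hence the same witness in both
   directions. *)
by split=> -[q Eq]; exists (a * r - q)%R; lra.
Qed.

Theorem theorem4p1 (n k k' : nat) (hk : 1 <= k < n) (hk' : 1 <= k' < n)
    (op : Q n -> Q n -> Q n) (op_canc : left_cancellative op)
    (op_trans : translatable k op) :
  translatable k' (dual op) <-> residue n (k * k')%N = 1.
Proof.
have n_gt1 : 1 < n by case/andP: hk; apply: leq_ltn_trans.
have n_gt0 := ltnW n_gt1.
have residue1 : residue n 1 = 1 by rewrite /residue modz_nat modn_small.
rewrite -[X in _ = X]residue1 residue_eq //; split=> [dual_trans|kk'1 i i' j Ei].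
  (* Rows [2] and [1] of the dual supply an instance of its translatability. *)
  have b1 : 1 <= 1 <= n by rewrite n_gt0.
  pose one : Q n := exist _ 1 b1; pose two : Q n := exist _ 2 n_gt1.
  apply/(dual_shift_eq op_canc op_trans two one one erefl).
  exact: dual_trans.
exact/(dual_shift_eq op_canc op_trans _ _ _ Ei).
Qed.
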